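(* Let $\Omega\subset\mathbb{R}^n$ be nonempty, compact and convex. Suppose that Assumption A (stated in the context) holds, and let $\{x_k\}_{k\ge 1}$ be a sequence generated by Algorithm SPS (described in the context) applied to $\min_{x\in\Omega} f(x)$, $f(x)=E(F(x,\xi))$, with $N_k\to\infty$. Assume also that there exists $G$ such that $\|\bar g_k\|\le G$ for all $k$. Then $$\liminf_{k\to\infty} f(x_k)=f^*\quad\text{a.s.}$$ Moreover, if $\sum_{k=1}^\infty e_k/k<\infty$, where $e_k:=\max_{x\in\Omega}|f_{\mathcal N_k}(x)-f(x)|$, then $$\lim_{k\to\infty}x_k=x^*\quad\text{a.s.}$$ for some $x^*\in X^*$ (where $x^*$ may depend on the sample path).
   Context: Problem: $\min_{x\in\Omega} f(x)=E(F(x,\xi))$, where $\Omega\subset\mathbb{R}^n$ is closed and convex, $(\mathcal A,\mathcal F,P)$ is a probability space, $\xi:\mathcal A\to\mathbb{R}^m$ is a random vector, and $F:\mathbb{R}^n\times\mathbb{R}^m\to\mathbb{R}$ is continuous and convex in $x$ and bounded from below. $X^*$ and $f^*$ denote the set of solutions and the optimal value of this problem. Here $\|\cdot\|$ is the Euclidean norm, $P_\Omega$ is the orthogonal projection onto $\Omega$, and $\partial$ is the convex subdifferential. Sample average approximation: $\xi_1,\xi_2,\dots$ are i.i.d. sample vectors distributed as $\xi$, $f_i(x)=F(x,\xi_i)$, and for a finite sample $\mathcal N$ with $N=|\mathcal N|$, $f_{\mathcal N}(x)=\frac1N\sum_{i\in\mathcal N}f_i(x)$. At iteration $k$ the sample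 is $\mathcal N_k$, with cardinality $N_k$. Assumption A: the functions $f_i(x)=F(x,\xi_i)$, $i=1,2,\dots$, are continuous, convex and bounded from below by a constant $C$; moreover $F$ is dominated by a $P$-integrable function on any compact subset of $\mathbb{R}^n$ (i.e. for every compact $S$ there is a $P$-integrable $M$ with $|F(x,\xi)|\le M(\xi)$ for all $x\in S$). Standing property of the samples (uniform law of large numbers): for every compact $S\subseteq\mathbb{R}^n$, if $N_k\to\infty$ then $\lim_{k\to\infty}\sup_{x\in S}|f_{\mathcal N_k}(x)-f(x)|=0$ a.s. Algorithm SPS: Given $N_1\in\mathbb N$, $x_1\in\Omega$, $0<C_1<1<C_2<\infty$, $0<\underline\zeta\le\overline\zeta<\infty$, $\zeta_1\in[\underline\zeta,\overline\zeta]$. For $k=1,2,\dots$: 1. choose any $\bar g_k\in\partial f_{\mathcal N_k}(x_k)$ and set $p_k=-\zeta_k\bar g_k$; 2. choose $\alpha_k\in[C_1/k,C_2/k]$; 3. set $x_{k+1}=P_\Omega(x_k+\alpha_kp_k)$ and $s_k=x_{k+1}-x_k$; 4. choose $N_{k+1}\in\mathbb N$ (and a sample $\mathcal N_{k+1}$ of that size); 5. choose $g_{\mathcal N_k}(x_{k+1})\in\partial f_{\mathcal N_k}(x_{k+1})$, set $y_k=g_{\mathcal N_k}(x_{k+1})-\bar g_k$ and $\zeta_{k+1}=\min\{\overline\zeta,\max\{\underline\zeta,\frac{s_k^Ts_k}{s_k^Ty_k}\}\}$ (if $s_k^Ty_k=0$, $\zeta_{k+1}$ is any element of $[\underline\zeta,\overline\zeta]$).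 *)

(* Defs.v *)
From HB Require Import structures.
From mathcomp Require Import all_boot all_order all_algebra finmap.
From mathcomp Require Import all_classical all_reals all_analysis.

Set Implicit Arguments.
Unset Strict Implicit.
Unset Printing Implicit Defensive.

Import Order.TTheory GRing.Theory Num.Theory.
Import numFieldNormedType.Exports.

Local Open Scope classical_set_scope.
Local Open Scope ring_scope.

(* Points of R^n are row vectors 'rV[R]_n.  The library norm on 'rV[R]_n is the
   sup norm: it induces the usual topology, but projections and bounds on
   vectors are stated with the Euclidean norm enorm.  Values of random vectors
   are tuples m.-tuple R, which carry the product (= Borel) sigma-algebra. *)

Section Euclidean.
Context {R : realType} {n : nat}.
Implicit Types (u v x p g : 'rV[R]_n) (S : set 'rV[R]_n) (h : 'rV[R]_n -> R).

Definition dot u v : R := \sum_(i < n) u 0 i * v 0 i.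

Definition enorm u : R := Num.sqrt (dot u u).

Definition is_orth_proj S x p : Prop :=
  S p /\ forall y, S y -> enorm (x - p) <= enorm (x - y).

Definition subdifferential h x : set 'rV[R]_n :=
  [set g | forall y, h x + dot g (y - x) <= h y].

Definition solutions S h : set 'rV[R]_n :=
  [set x | S x /\ forall y, S y -> h x <= h y].

Definition optimal_value S h : \bar R := ereal_inf [set (h y)%:E | y in S].

(* The real supremum of an unbounded set is 0 by convention; this case does not
   arise for a compact S when h1 and h2 are bounded on S. *)
Definition sup_dist S (h1 h2 : 'rV[R]_n -> R) : R :=
  sup [set `|h1 y - h2 y| | y in S].

End Euclidean.

Section Samples.
Context {d : measure_display} {T : measurableType d} {R : realType}.
Context (P : probability T R) {m : nat}.

Definition mutually_independent (X : nat -> {mfun T >-> m.-tuple R}) : Prop :=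
  forall (I : {fset nat}) (B : nat -> set (m.-tuple R)),
    (forall i, measurable (B i)) ->
    P (\bigcap_(i in [set` I]) (X i @^-1` B i)) =
    (\prod_(i <- I) P (X i @^-1` B i))%E.

Definition identically_distributed (X Y : {mfun T >-> m.-tuple R}) : Prop :=
  forall B : set (m.-tuple R), measurable B -> P (X @^-1` B) = P (Y @^-1` B).

Definition iid_copies (xi : {mfun T >-> m.-tuple R})
    (xis : nat -> {mfun T >-> m.-tuple R}) : Prop :=
  mutually_independent xis /\ forall i, identically_distributed (xis i) xi.

End Samples.

Section Problem.
Context {d : measure_display} {T : measurableType d} {R : realType}.
Context (P : probability T R) {n m : nat}.
Implicit Types (F : 'rV[R]_n -> m.-tuple R -> R)
  (xi : {mfun T >-> m.-tuple R}) (xis : nat -> {mfun T >-> m.-tuple R}).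

(* F is continuous and convex in its first argument and bounded from below;
   measurability in the second argument makes F x xi a random variable. *)
Definition admissible_integrand F : Prop :=
  [/\ forall z, continuous (fun x => F x z),
      forall z, convex_function [set: 'rV[R]_n] (fun x => F x z),
      forall x, measurable_fun [set: m.-tuple R] (F x) &
      exists c : R, forall x z, c <= F x z].

(* Real-valued; the expectation is finite whenever F is dominated on {x}. *)
Definition objective F xi (x : 'rV[R]_n) : R :=
  fine ('E_P[fun w => F x (xi w)])%E.

Definition sample_average F xis (N : {fset nat}) (w : T) (x : 'rV[R]_n) : R :=
  #|` N|%:R^-1 * \sum_(i <- N) F x (xis i w).

Definition dominated_on F xi (S : set 'rV[R]_n) : Prop :=
  exists M : m.-tuple R -> R,
    P.-integrable [set: T] (fun w => (M (xi w))%:E) /\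
    {ae P, forall w, forall x, S x -> `|F x (xi w)| <= M (xi w)}.

Definition assumptionA F xi xis : Prop :=
  [/\ forall i w, continuous (fun x => F x (xis i w)),
      forall i w, convex_function [set: 'rV[R]_n] (fun x => F x (xis i w)),
      exists C : R, forall i w x, C <= F x (xis i w) &
      forall S : set 'rV[R]_n, compact S -> dominated_on F xi S].

Definition uniform_LLN F xi xis (NN : nat -> T -> {fset nat}) : Prop :=
  forall S : set 'rV[R]_n, compact S ->
    {ae P, forall w, (fun k => #|` NN k w|) @ \oo --> \oo ->
      (fun k => sup_dist S (sample_average F xis (NN k w) w)
                           (objective F xi)) @ \oo --> (0 : R)}.

End Problem.

(* One realization of the algorithm.  Iterations are numbered from 1, so the
   terms of index 0 of the sequences are irrelevant.  fN N is the sample average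
   over the sample N; gbar k and gnext k are the chosen subgradients of
   fN (NN k) at x k and at x k.+1. *)
Record SPS_run (R : realType) (n : nat) (Omega : set 'rV[R]_n)
    (fN : {fset nat} -> 'rV[R]_n -> R)
    (N1 : nat) (x1 : 'rV[R]_n) (C1 C2 zlo zhi zeta1 : R)
    (NN : nat -> {fset nat}) (x gbar gnext : nat -> 'rV[R]_n)
    (alpha zeta : nat -> R) : Prop := {
  sps_sample1 : #|` NN 1%N| = N1 ;
  sps_x1 : x 1%N = x1 ;
  sps_zeta1 : zeta 1%N = zeta1 ;
  sps_sample : forall k, (0 < k)%N -> (0 < #|` NN k|)%N ;
  sps_gbar : forall k, (0 < k)%N -> subdifferential (fN (NN k)) (x k) (gbar k) ;
  sps_alpha : forall k, (0 < k)%N -> C1 / k%:R <= alpha k <= C2 / k%:R ;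
  sps_x : forall k, (0 < k)%N ->
    is_orth_proj Omega (x k + alpha k *: (- zeta k *: gbar k)) (x k.+1) ;
  sps_gnext : forall k, (0 < k)%N ->
    subdifferential (fN (NN k)) (x k.+1) (gnext k) ;
  sps_zeta : forall k, (0 < k)%N ->
    let s : 'rV[R]_n := x k.+1 - x k in
    let y : 'rV[R]_n := gnext k - gbar k in
    if dot s y == 0 then zlo <= zeta k.+1 <= zhi : Prop
    else zeta k.+1 = Num.min zhi (Num.max zlo (dot s s / dot s y))
}.

(* Main.v *)
Require Import Defs.
From HB Require Import structures.
From mathcomp Require Import all_boot all_order all_algebra finmap.
From mathcomp Require Import all_classical all_reals all_analysis.
From mathcomp Require Import measurable_realfun ring lra.

Set Implicit Arguments.
Unset Strict Implicit.
Unset Printing Implicit Defensive.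

Import Order.TTheory GRing.Theory Num.Theory.
Import numFieldNormedType.Exports.

Local Open Scope classical_set_scope.
Local Open Scope ring_scope.

(* Everything is pathwise.  Nonexpansiveness of the projection and the
   subgradient inequality for the sample average give, for y in Omega and with
   l_k = alpha_k * zeta_k of exact order 1/k,
     |x_{k+1} - y|^2 <=
       |x_k - y|^2 - 2 l_k (f x_k - f y - 2 e_k) + l_k^2 G^2.
   If f x_k stayed above f y + r, the divergence of the harmonic series would
   make the left-hand side negative.  If moreover the e_k / k are summable, the
   squared distances to any minimizer p decrease up to summable errors, so x_k
   converges to p once p is a cluster point; such a minimizer exists because f
   is continuous on Omega, as a uniform limit of sample averages along any path
   on which the law of large numbers holds. *)

(** * Euclidean geometry and the projected subgradient step *)

Section DotProduct.
Context {R : realType} {n : nat}.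
Implicit Types (u v w x y p : 'rV[R]_n) (S : set 'rV[R]_n).

Lemma dotC u v : dot u v = dot v u.
Proof. by apply: eq_bigr => i _; rewrite mulrC. Qed.

Lemma dotDl u v w : dot (u + v) w = dot u w + dot v w.
Proof. by rewrite -big_split; apply: eq_bigr => i _; rewrite mxE mulrDl. Qed.

Lemma dotZl a u v : dot (a *: u) v = a * dot u v.
Proof. by rewrite mulr_sumr; apply: eq_bigr => i _; rewrite mxE mulrA. Qed.

Lemma dotDr u v w : dot u (v + w) = dot u v + dot u w.
Proof. by rewrite dotC dotDl !(dotC u). Qed.

Lemma dotZr a u v : dot u (a *: v) = a * dot u v.
Proof. by rewrite dotC dotZl dotC. Qed.

Lemma dotNl u v : dot (- u) v = - dot u v.
Proof. by rewrite -scaleN1r dotZl mulN1r. Qed.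

Lemma dotNr u v : dot u (- v) = - dot u v.
Proof. by rewrite dotC dotNl dotC. Qed.

Lemma dot_ge0 u : 0 <= dot u u.
Proof. by apply: sumr_ge0 => i _; rewrite -expr2 sqr_ge0. Qed.

Lemma dot0l u : dot 0 u = 0.
Proof. by rewrite -(scale0r u) dotZl mul0r. Qed.

Lemma ler_enorm u v : (enorm u <= enorm v) = (dot u u <= dot v v).
Proof. by rewrite /enorm ler_sqrt ?dot_ge0. Qed.

Lemma enorm_le_dot u a : enorm u <= a -> dot u u <= a ^+ 2.
Proof.
move=> ua; rewrite -(sqr_sqrtr (dot_ge0 u)) lerXn2r// nnegrE ?sqrtr_ge0//.
exact: le_trans (sqrtr_ge0 _) ua.
Qed.

Definition dotE := (dotDl, dotDr, dotNl, dotNr, dotZl, dotZr).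

(** The library norm is the sup norm, which the Euclidean norm dominates; this turns estimates on
    squared distances into convergence in the library topology. *)
Lemma dot_sub_lt_norm u v (e : R) : 0 < e -> dot (u - v) (u - v) < e ^+ 2 ->
  `|u - v| < e.
Proof.
move=> e0 uve; rewrite [ltLHS]mx_normrE.
apply/bigmax_ltP; split=> // -[i j] _ /=.
rewrite ord1 -(@ltr_pXn2r _ 2%N) ?nnegrE ?(ltW e0)// real_normK ?num_real//.
apply: le_lt_trans uve; rewrite /dot (bigD1 j)//= -expr2 lerDl.
by apply: sumr_ge0 => k _; rewrite -expr2 sqr_ge0.
Qed.

Lemma dot_sub_continuous v : continuous (fun u => dot (u - v) (u - v)).
Proof.
apply: continuous_big => [|i _ u]; first exact: add_continuous.
have ci : continuous (fun z : 'rV[R]_n => (z - v) 0 i).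
  rewrite (_ : (fun z => _) = (fun z : 'rV[R]_n => z 0 i + (- v) 0 i)).
    move=> z; apply: continuousD; first exact: coord_continuous.
    exact: cst_continuous.
  by apply/funext => z; rewrite mxE.
by apply: continuousM; exact: ci.
Qed.

Lemma dot_le0_of_min u v :
  (forall t, 0 < t -> t <= 1 -> dot u u <= dot (u - t *: v) (u - t *: v)) ->
  dot u v <= 0.
Proof.
move=> minu; rewrite leNgt; apply/negP => c_gt0.
have v_ge0 := dot_ge0 v; have uv_gt0 : 0 < dot v v + dot u v by lra.
(* Minimality at [t] expands to [2 * dot u v <= t * dot v v], whereas this choice gives
   [t * dot v v < dot u v]. *)
pose t := dot u v / (dot v v + dot u v).
have t_gt0 : 0 < t by rewrite divr_gt0.
have t_le1 : t <= 1 by rewrite ler_pdivrMr//; lra.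
have tE : t * (dot v v + dot u v) = dot u v by rewrite divfK// gt_eqF.
have := minu _ t_gt0 t_le1; rewrite !dotE (dotC v u).
have := mulr_gt0 t_gt0 c_gt0; have := mulr_gt0 t_gt0 t_gt0; nra.
Qed.

(** By convexity the segment from [p] to [y] stays in [S], so the distance to [x] along it is
    minimal at [p]; this is the first-order condition there. *)
Lemma orth_proj_obtuse S x p y : convex_set S -> is_orth_proj S x p -> S y ->
  dot (x - p) (y - p) <= 0.
Proof.
move=> cS [Sp minp] Sy; apply: dot_le0_of_min => t t_gt0 t_le1.
have tS : S (p + t *: (y - p)).
  have := cS y p (Itv01 (ltW t_gt0) t_le1) (mem_set Sy) (mem_set Sp).
  rewrite inE; congr S; rewrite /conv/= /unstable.onem.
  by rewrite scalerBr scalerBl scale1r addrCA.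
by have := minp _ tS; rewrite ler_enorm opprD addrA.
Qed.

(** Expand the square of [(x - p) + (p - y)]: the cross term is nonnegative because the angle at [p]
    is obtuse. *)
Lemma orth_proj_le S x p y : convex_set S -> is_orth_proj S x p -> S y ->
  dot (p - y) (p - y) <= dot (x - y) (x - y).
Proof.
move=> cS xp Sy; have := orth_proj_obtuse cS xp Sy.
have -> : y - p = - (p - y) by rewrite opprB.
have -> : x - y = (x - p) + (p - y) by rewrite addrA subrK.
move: (x - p) (p - y) => u v; rewrite !dotE (dotC v u).
have := dot_ge0 u; lra.
Qed.

(** Projecting brings the point no farther from [y]; in the expansion of the squared distance before
    projection, the subgradient inequality at [y] controls the cross term. *)
Lemma projected_subgradient_step S (h : 'rV[R]_n -> R) x p g y (t G : R) :
  convex_set S -> 0 <= t -> enorm g <= G -> subdifferential h x g ->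
  is_orth_proj S (x - t *: g) p -> S y ->
  dot (p - y) (p - y) <=
    dot (x - y) (x - y) - 2 * t * (h x - h y) + t ^+ 2 * G ^+ 2.
Proof.
move=> cS t0 gG hg xp Sy; apply: le_trans (orth_proj_le cS xp Sy) _.
have := hg y; rewrite -[y - x]opprB addrAC dotNr.
move: (x - y) => u hu; rewrite !dotE (dotC u).
have := enorm_le_dot gG => gG2.
have := ler_wpM2l (sqr_ge0 t) gG2.
have : t * dot g u >= t * (h x - h y) by apply: ler_wpM2l => //; lra.
nra.
Qed.

End DotProduct.

(** * Real sequences: telescoping, tails, and divergence of the harmonic series *)

Section RealSequences.
Context {R : realType}.
Implicit Types (a u b : nat -> R).

Lemma ler_telescope a b i j : (i <= j)%N ->
  (forall k, (i <= k < j)%N -> a k.+1 <= a k + b k) ->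
  a j <= a i + \sum_(i <= k < j) b k.
Proof.
move=> ij ab; rewrite -lerBlDl -telescope_sumr// ler_sum_nat// => k kij.
by rewrite lerBlDl ab.
Qed.

(** Bounded monotone partial sums converge, hence satisfy the Cauchy criterion. *)
Lemma summable_tail u (B : R) : (forall k, 0 <= u k) ->
  (forall j, \sum_(0 <= k < j) u k <= B) ->
  forall e, 0 < e -> exists K, forall i j, (K <= i)%N ->
    \sum_(i <= k < j) u k < e.
Proof.
move=> u0 uB e e0.
have /cauchy_cvgP/cauchy_seriesP/(_ e e0) : cvgn (series u).
  apply: nondecreasing_is_cvgn; first exact: nondecreasing_series.
  by exists B => _ [j _ <-]; exact: uB.
move=> [[/= P Q] [[K1 _ KP] [K2 _ KQ]] PQ].
exists (maxn K1 K2) => i j; rewrite geq_max => /andP[K1i K2i].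
have [ij|ji] := leqP i j; last by rewrite big_geq// ltnW.
apply: le_lt_trans (ler_norm _) _.
apply: (PQ (i, j)); split; first exact: KP.
by apply: KQ; exact: leq_trans ij.
Qed.

(* The term of index 0 is [0^-1 = 0]. *)
Lemma sum_inv_sqr_le j : \sum_(0 <= k < j) (k%:R ^- 2 : R) <= 2.
Proof.
(* The sharper bound is inductive, since [(x + 1) ^- 2 <= x^-1 - (x + 1)^-1]. *)
suff H i : \sum_(0 <= k < i.+2) (k%:R ^- 2 : R) <= 2 - i.+1%:R^-1.
  case: j => [|[|j]]; first by rewrite big_geq.
    by rewrite big_nat1 expr0n/= invr0.
  by apply: le_trans (H j) _; rewrite gerBl invr_ge0.
elim: i => [|i IH].
  by rewrite big_nat_recl// big_nat1 expr0n/= invr0 expr1n invr1; lra.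
rewrite big_nat_recr//=; apply: le_trans (lerD IH (lexx _)) _.
have i1 : 0 < i.+1%:R :> R by [].
rewrite -[i.+2%:R]natr1; move: (i.+1%:R) i1 => x x0.
have -> : (x + 1) ^- 2 = x^-1 - (x + 1)^-1 - (x ^-1 * (x + 1) ^- 2).
  field; lra.
have : 0 <= x^-1 * (x + 1) ^- 2.
  by rewrite mulr_ge0// invr_ge0 ?exprn_ge0; lra.
lra.
Qed.

(** Telescoping from [K] bounds [c] times the sum of the [1 / k] by [a K + D * 2], so the harmonic
    series would converge. *)
Lemma harmonic_decrease_absurd a (c D : R) K : 0 < c -> 0 <= D ->
  (forall k, 0 <= a k) ->
  (forall k, (K <= k)%N -> a k.+1 <= a k - c / k%:R + D / k%:R ^+ 2) -> False.
Proof.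
move=> c0 D0 a0 aD; apply: (@dvg_harmonic R).
apply: nondecreasing_is_cvgn.
  by apply: nondecreasing_series => k _ _; rewrite /harmonic/= invr_ge0.
exists (\sum_(0 <= k < K) k%:R^-1 + (a K + D * 2) / c) => _ [j _ <-].
have -> : series harmonic j = \sum_(0 <= k < j.+1) k%:R^-1 :> R.
  by rewrite big_nat_recl// invr0 add0r.
have inv_ge0 k : 0 <= k%:R^-1 :> R by rewrite invr_ge0.
have sqr_inv_ge0 k : 0 <= k%:R ^- 2 :> R by rewrite invr_ge0 exprn_ge0.
(* Extending the range to [l] lets the sum be split at [K] even when [j.+1 < K]. *)
pose l := maxn K j.+1; have Kl : (K <= l)%N := leq_maxl _ _.
apply: (@le_trans _ _ (\sum_(0 <= k < l) k%:R^-1)).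
  by rewrite [leRHS](@big_cat_nat _ _ _ j.+1) ?leq_maxr//= lerDl sumr_ge0.
rewrite (@big_cat_nat _ _ _ K)//= lerD2l ler_pdivlMr// mulrC.
have := @ler_telescope a (fun k => - c * k%:R^-1 + D * k%:R ^- 2) K l Kl.
rewrite big_split/= -!mulr_sumr => /(_ _)/wrap[|H].
  by move=> k /andP[Kk _]; rewrite addrA mulNr aD.
have : D * \sum_(K <= k < l) k%:R ^- 2 <= D * 2.
  rewrite ler_wpM2l//; apply: le_trans (sum_inv_sqr_le l).
  by rewrite [leRHS](@big_cat_nat _ _ _ K)//= lerDr sumr_ge0.
have := a0 l; lra.
Qed.

End RealSequences.

(** * Near-optimal iterates and their cluster points *)

Section PerturbedDescent.
Context {R : realType} {n : nat}.
Context (S : set 'rV[R]_n) (f : 'rV[R]_n -> R) (x : nat -> 'rV[R]_n).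

(** This is the upper bound of the limit inferior of [f (x k)] by the infimum of [f] on [S], stated
    without extended reals. *)
Definition frequently_near_optimal :=
  forall y, S y -> forall (r : R) K, 0 < r ->
  exists2 k, (K <= k)%N & f (x k) < f y + r.

Lemma limn_einf_optimal_value : (forall k, (0 < k)%N -> S (x k)) ->
  frequently_near_optimal ->
  limn_einf (fun k => (f (x k))%:E) = optimal_value S f.
Proof.
move=> xS freq; rewrite limn_einf_lim; apply/eqP; rewrite eq_le; apply/andP.
split.
  apply: le_ereal_inf_tmp => _ [y Sy <-]; apply: lime_le.
    exact: is_cvg_einfs.
  apply: nearW => K; apply/lee_addgt0Pr => r r0.
  have [k Kk fk] := freq y Sy r K r0.
  apply: ge_ereal_inf; exists (f (x k))%:E; first by exists k.
  by rewrite -EFinD lee_fin ltW.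
apply: lime_ge; first exact: is_cvg_einfs.
(* Only tails from index 1 on are used, because [x 0] is not constrained to [S]. *)
exists 1%N => // K /= K0; apply: le_ereal_inf_tmp => _ [k /= Kk <-].
by apply: ereal_inf_lbound; exists (x k) => //; apply: xS; exact: leq_trans Kk.
Qed.

(** Choose indices [kf j > j] whose values exceed the minimum by less than [1 / (j + 1)].
    Compactness gives this subsequence a cluster point, which is a minimizer by continuity. *)
Lemma near_optimal_cluster : S !=set0 -> compact S ->
  {within S, continuous f} -> (forall k, (0 < k)%N -> S (x k)) ->
  frequently_near_optimal ->
  exists2 p, solutions S f p & forall B, nbhs p B -> forall K,
    exists2 k, (K < k)%N & B (x k).
Proof.
move=> S0 cS cf xS freq.
have [z0 z0S minz] := EVT_min_rV S0 cS cf; rewrite inE in z0S.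
have /choice[kf kfP] : forall j, exists k,
    (j < k)%N /\ f (x k) < f z0 + harmonic j.
  move=> j; have [|k jk fk] := freq z0 z0S (harmonic j) j.+1.
    exact: harmonic_gt0.
  by exists k.
have zS j : S (x (kf j)) by apply: xS; have [+ _] := kfP j; apply: leq_trans.
have [p [Sp clp]] : S `&` cluster (x \o kf @ \oo) !=set0.
  by apply: cS; exists 0%N => // j _; exact: zS.
have clP B J : nbhs p B -> exists2 j, (J <= j)%N & B (x (kf j)).
  move=> pB; pose A := (x \o kf) @` [set j | (J <= j)%N].
  have [|_ [[j Jj <-] Bj]] := clp A B _ pB.
    by exists J => // j Jj; exists j.
  by exists j.
exists p; last first.
  move=> B pB K; have [j Kj Bj] := clP B K pB; exists (kf j) => //.
  by have [+ _] := kfP j; apply: leq_ltn_trans.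
split=> // y Sy; have fz0 : f z0 <= f y by apply: minz; rewrite inE.
apply: le_trans fz0.
apply/ler_addgt0Pr => r r0; have r2 : 0 < r / 2 by rewrite divr_gt0.
have [J _ HJ] : \forall j \near \oo, `|0 - harmonic j| < r / 2.
  by move/cvgrPdist_lt: (@cvg_harmonic R); exact.
have : nbhs p [set z | S z -> `|f p - f z| < r / 2].
  by have /subspace_continuousP/(_ p Sp)/cvgrPdist_lt/(_ _ r2) := cf.
move=> /(clP _ J)[j Jj /= /(_ (zS j))].
have := HJ j Jj; have [_] := kfP j; rewrite sub0r normrN.
rewrite (ger0_norm (harmonic_ge0 _)) ltr_norml => ? ? /andP[]; lra.
Qed.

(** * Consequences of the descent inequality with errors [e] *)

Context (lam e : nat -> R) (c D G : R).
Context (c_gt0 : 0 < c)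
  (lamP : forall k, (0 < k)%N -> c / k%:R <= lam k <= D / k%:R)
  (e_ge0 : forall k, 0 <= e k)
  (descent : forall k y, (0 < k)%N -> S y ->
    dot (x k.+1 - y) (x k.+1 - y) <=
    dot (x k - y) (x k - y) - 2 * lam k * (f (x k) - f y - 2 * e k)
      + lam k ^+ 2 * G ^+ 2).

Let lam_ge0 k : (0 < k)%N -> 0 <= lam k.
Proof. by move=> /lamP/andP[+ _]; apply: le_trans; rewrite divr_ge0// ltW. Qed.

Let lam_sqr k : (0 < k)%N -> lam k ^+ 2 * G ^+ 2 <= D ^+ 2 * G ^+ 2 / k%:R ^+ 2.
Proof.
move=> k0; have /andP[_ lamD] := lamP k0.
rewrite [leRHS]mulrAC ler_wpM2r ?sqr_ge0// -expr_div_n.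
by rewrite lerXn2r ?nnegrE ?lam_ge0// (le_trans (lam_ge0 k0)).
Qed.

Lemma descent_frequently_near_optimal : e @ \oo --> (0 : R) ->
  frequently_near_optimal.
Proof.
move=> e0 y Sy r K r0; apply: contrapT => far.
have {}far k : (K <= k)%N -> f y + r <= f (x k).
  by move=> Kk; rewrite leNgt; apply/negP => fk; apply: far; exists k.
(* Once [e k < r / 4], the gap [f (x k) - f y - 2 * e k] is at least [r / 2], so the first-order
   decrease is at least [c * r / k]. *)
have r4 : 0 < r / 4 by lra.
move/cvgrPdist_lt: e0 => /(_ _ r4)[K' _ eK'].
apply: (@harmonic_decrease_absurd _ (fun k => dot (x k - y) (x k - y))
  (c * r) (D ^+ 2 * G ^+ 2) (maxn 1 (maxn K K'))) => //.
- exact: mulr_gt0.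
- by rewrite mulr_ge0 ?sqr_ge0.
- by move=> k; exact: dot_ge0.
move=> k; rewrite !geq_max => /and3P[k0 Kk K'k].
have := eK' k K'k; rewrite /= sub0r normrN ger0_norm// => ek.
have : lam k * (r / 2) <= lam k * (f (x k) - f y - 2 * e k).
  by rewrite ler_wpM2l ?lam_ge0//; have := far _ Kk; lra.
have : c * r / k%:R <= lam k * r.
  by rewrite mulrAC ler_wpM2r ?(ltW r0)//; case/andP: (lamP k0).
have := descent k0 Sy; have := lam_sqr k0; lra.
Qed.

(** Quasi-Fejer argument: beyond an index where [x] is close to the cluster point [p], the squared
    distance to [p] can grow only by a tail of a summable series. *)
Lemma descent_cvg_solution : S !=set0 -> compact S ->
  {within S, continuous f} -> (forall k, (0 < k)%N -> S (x k)) ->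
  frequently_near_optimal ->
  (\sum_(1 <= k <oo) (e k / k%:R)%:E < +oo)%E ->
  exists2 xstar, solutions S f xstar & x @ \oo --> xstar.
Proof.
move=> S0 cS cf xS freq sum_e.
have [p pS freqp] := near_optimal_cluster S0 cS cf xS freq.
exists p => //; have [Sp minp] := pS.
have D_ge0 : 0 <= D.
  by have := lam_ge0 (ltn0Sn 0); have /andP[_] := lamP (ltn0Sn 0); lra.
pose a k := dot (x k - p) (x k - p).
(* What remains of the descent at [p] after the nonnegative term [lam k * (f (x k) - f p)] is
   dropped and [lam k] is bounded by [D / k]. *)
pose b k := 4 * D * (e k / k%:R) + D ^+ 2 * G ^+ 2 * k%:R ^- 2.
have DG_ge0 : 0 <= D ^+ 2 * G ^+ 2 by rewrite -exprMn sqr_ge0.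
have ek_ge0 k : 0 <= e k / k%:R by rewrite divr_ge0.
have b_ge0 k : 0 <= b k.
  apply: addr_ge0; apply: mulr_ge0 => //; exact: mulr_ge0.
have ab k : (0 < k)%N -> a k.+1 <= a k + b k.
  move=> k0; rewrite /a /b.
  have : 0 <= lam k * (f (x k) - f p).
    by rewrite mulr_ge0 ?lam_ge0// subr_ge0 minp//; exact: xS.
  have : lam k * e k <= D * (e k / k%:R).
    by rewrite mulrCA mulrC ler_wpM2l//; case/andP: (lamP k0).
  have := descent k0 Sp; have := lam_sqr k0; lra.
have [M bM] : exists M, forall j, \sum_(0 <= k < j) b k <= M.
  exists (4 * D * fine (\sum_(1 <= k <oo) (e k / k%:R)%:E)%E
          + D ^+ 2 * G ^+ 2 * 2) => j.
  rewrite big_split/= -!mulr_sumr; apply: lerD; apply: ler_wpM2l => //.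
  - exact: mulr_ge0.
  - have ekE_ge0 k : (1 <= k)%N -> true -> (0 <= (e k / k%:R)%:E)%E.
      by rewrite lee_fin.
    rewrite -lee_fin fineK ?ge0_fin_numE//; last exact: nneseries_ge0.
    apply: le_trans (nneseries_lim_ge j ekE_ge0); rewrite sumEFin lee_fin.
    (* The finite sum starts at 0 and the series at 1; the extra term is [e 0 / 0 = 0]. *)
    case: j => [|j]; first by rewrite !big_geq.
    by rewrite big_nat_recl// invr0 mulr0 add0r big_add1.
  - exact: sum_inv_sqr_le.
apply/cvgrPdist_lt => r r0.
(* Half of [r ^+ 2] is for the squared distance at the index [k] near [p], half for the tail of
   [b]. *)
have r2 : 0 < r ^+ 2 / 2 by rewrite divr_gt0 ?exprn_gt0.
have [K tailK] := summable_tail b_ge0 bM r2.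
have nearp : nbhs p [set z | dot (z - p) (z - p) < r ^+ 2 / 2].
  apply: (@dot_sub_continuous _ _ p p [set t | t < r ^+ 2 / 2]).
  by apply: lt_nbhsl; rewrite subrr dot0l.
have [k Kk xk] := freqp _ nearp K.
exists k => // j /= kj; rewrite distrC; apply: dot_sub_lt_norm => //.
apply: (@le_lt_trans _ _ (a k + \sum_(k <= i < j) b i)).
  apply: ler_telescope => // i /andP[ki _]; apply: ab.
  exact: leq_ltn_trans (leq_trans Kk ki).
have := tailK k j (ltnW Kk); move: xk; rewrite /= -/(a k); lra.
Qed.

End PerturbedDescent.

(** * Uniform distance and continuity of uniform limits *)

Section SupDist.
Context {R : realType} {n : nat}.
Implicit Types (S : set 'rV[R]_n) (h f : 'rV[R]_n -> R).

Lemma sup_dist_ge0 S h f : 0 <= sup_dist S h f.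
Proof.
rewrite /sup_dist; case: (pselect (has_sup [set `|h y - f y| | y in S])).
  move=> [[_ [y Sy _]] ub].
  apply: le_trans (normr_ge0 (h y - f y)) _.
  by apply: ub_le_sup => //; exists y.
by move=> nosup; rewrite sup_out.
Qed.

(** The bounds [A] and [B] ensure that the real supremum is a genuine upper bound and not its
    default value 0. *)
Lemma ler_sup_dist S h f y (A B : R) : (forall z, S z -> `|h z| <= A) ->
  (forall z, S z -> `|f z| <= B) -> S y -> `|h y - f y| <= sup_dist S h f.
Proof.
move=> hA fB Sy; apply: ub_le_sup; last by exists y.
exists (A + B) => _ [z Sz <-]; apply: le_trans (ler_normB _ _) _.
by rewrite lerD ?hA ?fB.
Qed.

Lemma continuous_compact_bounded S h : compact S -> continuous h ->
  exists A, forall z, S z -> `|h z| <= A.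
Proof.
move=> cS ch; have [A [_ hA]] : bounded_set (h @` S).
  apply/compact_bounded/continuous_compact => //.
  exact: continuous_subspaceT.
by exists (A + 1) => z Sz; apply: hA; [rewrite ltrDl|exists z].
Qed.

(** The three-epsilon argument, with a single [h k] uniformly within [r / 3] of [f]. *)
Lemma sup_dist_cvg_continuous S f (h : nat -> 'rV[R]_n -> R) B :
  compact S -> (forall k, continuous (h k)) -> (forall z, S z -> `|f z| <= B) ->
  (fun k => sup_dist S (h k) f) @ \oo --> (0 : R) ->
  {within S, continuous f}.
Proof.
move=> cS ch fB h0; apply/subspace_continuousP => y Sy.
apply/cvgrPdist_lt => r r0; have r3 : 0 < r / 3 by rewrite divr_gt0.
move/cvgrPdist_lt: h0 => /(_ _ r3)[k _ /(_ k (leqnn k))].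
rewrite /= sub0r normrN ger0_norm ?sup_dist_ge0// => hr.
have [A hA] := continuous_compact_bounded cS (ch k).
have hf z : S z -> `|h k z - f z| < r / 3.
  by move=> Sz; exact: le_lt_trans (ler_sup_dist hA fB Sz) hr.
have : nbhs y [set z | `|h k y - h k z| < r / 3].
  by have /cvgrPdist_lt/(_ _ r3) := ch k y.
suff sub z : `|h k y - h k z| < r / 3 -> S z -> `|f y - f z| < r.
  by apply: filterS => z; exact: sub.
move=> hyz Sz.
have := hf _ Sz; have := hf _ Sy; move: hyz.
rewrite !ltr_norml => /andP[? ?] /andP[? ?] /andP[? ?]; apply/andP; split; lra.
Qed.

End SupDist.

(** * Sample averages and boundedness of the objective *)

Section Objective.
Context {d : measure_display} {T : measurableType d} {R : realType}.
Context (P : probability T R) {n m : nat}.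
Implicit Types (F : 'rV[R]_n -> m.-tuple R -> R).

Lemma sample_average_continuous F xis N (w : T) :
  (forall z, continuous (fun x => F x z)) ->
  continuous (sample_average F xis N w).
Proof.
move=> cF x.
apply: (@continuousM _ _ (cst _) (fun y => \sum_(i <- N) F y (xis i w))).
  exact: cst_continuous.
by apply: continuous_big => [|i _]; [exact: add_continuous|exact: cF].
Qed.

(** The integral of the absolute value of the dominating function bounds every expectation,
    uniformly over [S]. *)
Lemma objective_bounded F (xi : {mfun T >-> m.-tuple R}) (S : set 'rV[R]_n) :
  (forall x, measurable_fun [set: m.-tuple R] (F x)) -> dominated_on P F xi S ->
  exists B, forall x, S x -> `|objective P F xi x| <= B.
Proof.
move=> mF [M [intM FM]]; have [mM Moo] := integrableP _ _ _ intM.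
exists (fine (\int[P]_w `|(M (xi w))%:E|)%E) => x Sx.
have mFx : measurable_fun [set: T] (EFin \o (F x \o xi)).
  by apply/measurable_EFinP; exact: measurableT_comp.
have FMle : (\int[P]_w `|(F x (xi w))%:E| <= \int[P]_w `|(M (xi w))%:E|)%E.
  apply: ae_ge0_le_integral => //.
  - exact: measurableT_comp.
  - exact: measurableT_comp.
  apply: filterS FM => w FMw _; rewrite lee_fin.
  by apply: le_trans (FMw x Sx) (ler_norm _).
have le_int := le_trans (le_abse_integral P measurableT mFx) FMle.
rewrite /objective unlock.
have Efin : (\int[P]_w (EFin \o (F x \o xi)) w)%E \is a fin_num.
  by rewrite -abse_fin_num ge0_fin_numE// (le_lt_trans le_int).
have Mfin : (\int[P]_w `|(M (xi w))%:E|)%E \is a fin_num.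
  by rewrite ge0_fin_numE ?integral_ge0.
by have := le_int; rewrite -{1}(fineK Efin) -{1}(fineK Mfin) lee_fin.
Qed.

End Objective.

(** * One run of the algorithm: feasibility, step sizes, descent *)

Section Realization.
Context {R : realType} {n : nat} {Omega : set 'rV[R]_n}.
Context {fN : {fset nat} -> 'rV[R]_n -> R} {N1 : nat} {x1 : 'rV[R]_n}.
Context {C1 C2 zlo zhi zeta1 : R} {NN : nat -> {fset nat}}.
Context {x gbar gnext : nat -> 'rV[R]_n} {alpha zeta : nat -> R}.
Context (C1_gt0 : 0 < C1) (zlo_gt0 : 0 < zlo) (zlohi : zlo <= zhi).
Context (x1_Omega : Omega x1) (zeta1_itv : zlo <= zeta1 <= zhi).
Context (run : SPS_run Omega fN N1 x1 C1 C2 zlo zhi zeta1 NN x gbar gnext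
  alpha zeta).

Lemma SPS_mem k : (0 < k)%N -> Omega (x k).
Proof.
case: k => [//|[|k]] _; first by have -> := sps_x1 run.
by have [] := sps_x run (ltn0Sn k).
Qed.

Lemma SPS_zeta_itv k : (0 < k)%N -> zlo <= zeta k <= zhi.
Proof.
case: k => [//|[|k]] _; first by have -> := sps_zeta1 run.
have /= := sps_zeta run (ltn0Sn k); case: ifP => // _ ->.
by rewrite le_min zlohi le_max lexx/= ge_min lexx.
Qed.

(** The effective step along [- gbar k] is [alpha k * zeta k]; safeguarding [zeta] keeps it of exact
    order [1 / k]. *)
Lemma SPS_step_itv k : (0 < k)%N ->
  C1 * zlo / k%:R <= alpha k * zeta k <= C2 * zhi / k%:R.
Proof.
move=> k0; have /andP[a1 a2] := sps_alpha run k0.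
have /andP[z1 z2] := SPS_zeta_itv k0.
have C1k : 0 <= C1 / k%:R by rewrite divr_ge0// ltW.
rewrite (mulrAC C1) (mulrAC C2); apply/andP; split; apply: ler_pM => //.
- exact: ltW.
- exact: le_trans C1k a1.
- exact: le_trans (ltW zlo_gt0) z1.
Qed.

(** The projected step decreases the sample average; replacing it by [f] costs one uniform error at
    [x k] and one at [y], hence the factor 2. *)
Lemma SPS_descent (f : 'rV[R]_n -> R) (G : R) k y : convex_set Omega ->
  (forall z, Omega z -> `|fN (NN k) z - f z| <= sup_dist Omega (fN (NN k)) f) ->
  enorm (gbar k) <= G -> (0 < k)%N -> Omega y ->
  dot (x k.+1 - y) (x k.+1 - y) <= dot (x k - y) (x k - y)
    - 2 * (alpha k * zeta k)
        * (f (x k) - f y - 2 * sup_dist Omega (fN (NN k)) f)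
    + (alpha k * zeta k) ^+ 2 * G ^+ 2.
Proof.
move=> cO he gG k0 Oy.
have t0 : 0 <= alpha k * zeta k.
  have /andP[+ _] := SPS_step_itv k0; apply: le_trans.
  by rewrite divr_ge0// mulr_ge0// ltW.
have := sps_x run k0; rewrite scaleNr scalerN scalerA => proj.
have := projected_subgradient_step cO t0 gG (sps_gbar run k0) proj Oy.
have := he _ Oy; have := he _ (SPS_mem k0); move: (sup_dist _ _ _) => e.
rewrite !ler_norml => /andP[? ?] /andP[? ?].
have : alpha k * zeta k * (f (x k) - f y - 2 * e) <=
       alpha k * zeta k * (fN (NN k) (x k) - fN (NN k) y).
  by rewrite ler_wpM2l//; lra.
lra.
Qed.

End Realization.

(** * From single sample paths to almost sure convergence *)

Theorem theorem3p1 (R : realType) (d : measure_display) (T : measurableType d)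
    (P : probability T R) (n m : nat)
    (Omega : set 'rV[R]_n) (F : 'rV[R]_n -> m.-tuple R -> R)
    (xi : {mfun T >-> m.-tuple R}) (xis : nat -> {mfun T >-> m.-tuple R})
    (N1 : nat) (x1 : 'rV[R]_n) (C1 C2 zlo zhi zeta1 : R)
    (NN : nat -> T -> {fset nat}) (x gbar gnext : nat -> T -> 'rV[R]_n)
    (alpha zeta : nat -> T -> R) (G : R)
    (f := objective P F xi)
    (fN := sample_average F xis)
    (e := fun (k : nat) (w : T) => sup_dist Omega (fN (NN k w) w) f)
    (Omega_neq0 : Omega !=set0)
    (Omega_compact : compact Omega)
    (Omega_convex : convex_set Omega)
    (F_adm : admissible_integrand F)
    (xis_iid : iid_copies P xi xis)
    (HA : assumptionA P F xi xis)
    (HULLN : uniform_LLN P F xi xis NN)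
    (N1_gt0 : (0 < N1)%N)
    (x1_Omega : Omega x1)
    (C12 : [/\ 0 < C1, C1 < 1 & 1 < C2])
    (zlohi : 0 < zlo /\ zlo <= zhi)
    (zeta1_itv : zlo <= zeta1 <= zhi)
    (Hrun : forall w : T,
      SPS_run Omega (fun N => fN N w) N1 x1 C1 C2 zlo zhi zeta1
        (NN ^~ w) (x ^~ w) (gbar ^~ w) (gnext ^~ w) (alpha ^~ w) (zeta ^~ w))
    (NN_oo : {ae P, forall w, (fun k => #|` NN k w|) @ \oo --> \oo})
    (gbar_bounded : {ae P, forall w, forall k, (0 < k)%N ->
      enorm (gbar k w) <= G}) :
  {ae P, forall w,
    limn_einf (fun k => (f (x k w))%:E) = optimal_value Omega f} /\
  ({ae P, forall w, (\sum_(1 <= k <oo) (e k w / k%:R)%:E < +oo)%E} ->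
   {ae P, forall w, exists2 xstar, solutions Omega f xstar &
      x ^~ w @ \oo --> xstar}).

Proof.
have [C1_gt0 _ _] := C12; have [zlo_gt0 zlo_le] := zlohi.
have [cF _ mF _] := F_adm; have [_ _ _ dom] := HA.
have [B fB] := objective_bounded mF (dom _ Omega_compact).
have e_cvg : {ae P, forall w, e ^~ w @ \oo --> (0 : R)}.
  by apply: filterS2 _ NN_oo (HULLN _ Omega_compact) => w NNw; exact.
have xO w k : (0 < k)%N -> Omega (x k w).
  by move=> k0; exact: (SPS_mem x1_Omega (Hrun w)).
have c_gt0 : 0 < C1 * zlo by exact: mulr_gt0.
have lamP w k : (0 < k)%N -> C1 * zlo / k%:R <= alpha k w * zeta k w
    <= C2 * zhi / k%:R.
  by move=> k0; exact: (SPS_step_itv C1_gt0 zlo_gt0 zlo_le zeta1_itv (Hrun w)).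
have e_ge0 w k : 0 <= e k w by exact: sup_dist_ge0.
have fN_cont N w : continuous (fN N w) by exact: sample_average_continuous.
have descent w : (forall k, (0 < k)%N -> enorm (gbar k w) <= G) ->
    forall k y, (0 < k)%N -> Omega y ->
    dot (x k.+1 w - y) (x k.+1 w - y) <= dot (x k w - y) (x k w - y)
      - 2 * (alpha k w * zeta k w) * (f (x k w) - f y - 2 * e k w)
      + (alpha k w * zeta k w) ^+ 2 * G ^+ 2.
  move=> gG k y k0; apply: (SPS_descent C1_gt0 zlo_gt0 zlo_le x1_Omega
    zeta1_itv (Hrun w) Omega_convex) => //; last exact: gG.
  have [A hA] := continuous_compact_bounded Omega_compact (fN_cont (NN k w) w).
  by move=> z Oz; exact: ler_sup_dist hA fB Oz.
have freq : {ae P, forall w, frequently_near_optimal Omega f (x ^~ w)}.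
  apply: filterS2 _ e_cvg gbar_bounded => w ew gG.
  exact: (descent_frequently_near_optimal c_gt0 (lamP w) (e_ge0 w)
    (descent w gG)).
split.
  by apply: filterS freq => w; apply: limn_einf_optimal_value; exact: xO.
(* Fix a path in the intersection of the finitely many almost sure events used below. *)
move=> sum_e; near=> w.
have ew : e ^~ w @ \oo --> (0 : R) by near: w.
have gG : forall k, (0 < k)%N -> enorm (gbar k w) <= G by near: w.
have fr : frequently_near_optimal Omega f (x ^~ w) by near: w.
(* Although [f] is deterministic, its continuity is read off the sample averages along this path. *)
have f_cont : {within Omega, continuous f}.
  exact: (sup_dist_cvg_continuous Omega_compact
    (fun k => fN_cont (NN k w) w) fB ew).
apply: (descent_cvg_solution c_gt0 (lamP w) (e_ge0 w) (descent w gG)) => //.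
  exact: xO.
by near: w.
Unshelve. all: end_near. Qed.
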